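(* Let $G$ be a finitely generated solvable group. Then $F'$ consists of weak* identities in $G$ (i.e. modulo the trivial $T$-subgroup $\{1\}$).
   Context: Let $F$ be the free group on countably many generators $g_1,g_2,\dots$, and $F'=[F,F]$. For $N\ge 1$, $F^{\times N}$ is the direct product of $N$ copies of $F$, $i_k:F\to F^{\times N}$ the $k$-th inclusion. A subset $S\subset F$ is a set of weak identities in a group $G$ if there exists $N\ge1$ such that for any $s_1,\dots,s_N\in S$ and any homomorphism $\rho:F^{\times N}\to G$ some $k$ has $\rho(i_k(s_k))=1$. A $T$-subgroup of $F$ is a subgroup preserved by all endomorphisms of $F$. For a $T$-subgroup $\mathcal{H}$, $\mathcal{H}(G)=\{\pi(h):h\in\mathcal{H},\ \pi:F\to G\text{ a homomorphism}\}$. $S$ consists of weak identities modulo $\mathcal{H}$ in $G$ if $S$ is a set of weak identities in $G/\mathcal{H}(G)$. A $T$-subgroup $\mathcal{S}$ consists of weak* identities in $G$ modulo a $T$-subgroup $\mathcal{H}$ if there exist $m\ge0$ and $T$-subgroups $\mathcal{S}_0=\mathcal{S},\dots,\mathcal{S}_m=\mathcal{H}$ such that $\mathcal{S}_{j-1}$ consists of weak identities modulo $\mathcal{S}_j$ in $G$ for all $j=1,\dots,m$. *)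

(* Defs.v *)
(* Abstract, possibly infinite
   groups are represented as setoid groups: a carrier with operations and an
   equivalence relation playing the role of equality. *)
From Stdlib Require Import List.
From mathcomp Require Import all_boot.
Set Implicit Arguments. Unset Strict Implicit. Unset Printing Implicit Defensive.

Record grp := Grp {
  car :> Type;
  geq : car -> car -> Prop;
  gmul : car -> car -> car;
  ginv : car -> car;
  gone : car }.
Arguments geq {g}. Arguments gmul {g}. Arguments ginv {g}. Arguments gone {g}.

Definition is_group (G : grp) : Prop :=
  (forall x : G, geq x x) /\
  (forall x y : G, geq x y -> geq y x) /\
  (forall x y z : G, geq x y -> geq y z -> geq x z) /\
  (forall x x' y y' : G, geq x x' -> geq y y' -> geq (gmul x y) (gmul x' y')) /\
  (forall x x' : G, geq x x' -> geq (ginv x) (ginv x')) /\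
  (forall x y z : G, geq (gmul x (gmul y z)) (gmul (gmul x y) z)) /\
  (forall x : G, geq (gmul gone x) x) /\
  (forall x : G, geq (gmul (ginv x) x) gone).

Definition is_hom (G H : grp) (f : G -> H) : Prop :=
  (forall x y, geq x y -> geq (f x) (f y)) /\
  (forall x y, geq (f (gmul x y)) (gmul (f x) (f y))).

Definition gprod (G : grp) (l : seq G) : G := foldr (@gmul G) (@gone G) l.
Definition gcomm (G : grp) (x y : G) : G :=
  gmul (gmul (ginv x) (ginv y)) (gmul x y).

Definition derived (G : grp) (P : G -> Prop) (x : G) : Prop :=
  exists l : seq (G * G), (forall p, In p l -> P p.1 /\ P p.2) /\
     geq x (gprod [seq gcomm p.1 p.2 | p <- l]).

Definition solvable_grp (G : grp) : Prop :=
  exists n, forall x : G, iter n (@derived G) (fun _ => True) x -> geq x gone.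

(* a letter (i, b) is g_i if b = false and g_i^{-1} if b = true *)
Definition word := seq (nat * bool).

Inductive freq : word -> word -> Prop :=
| freq_refl w : freq w w
| freq_sym w v : freq w v -> freq v w
| freq_trans u v w : freq u v -> freq v w -> freq u w
| freq_cat u u' v v' : freq u u' -> freq v v' -> freq (u ++ v) (u' ++ v')
| freq_cancel i b : freq [:: (i, b); (i, ~~ b)] [::].

Definition winv (w : word) : word := rev [seq (p.1, ~~ p.2) | p <- w].

Definition FreeG : grp := @Grp word freq cat winv [::].

Definition weval (G : grp) (a : nat -> G) (w : word) : G :=
  gprod [seq (if p.2 then ginv (a p.1) else a p.1) | p <- w].

Definition fin_gen (G : grp) : Prop :=
  exists gens : seq G, forall x : G, exists w : word,
    (forall p, p \in w -> p.1 < size gens) /\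
    geq (weval (fun i => nth gone gens i) w) x.

(* subsets of F are predicates on words compatible with freq *)
Definition subgroupF (H : word -> Prop) : Prop :=
  [/\ (forall w v, freq w v -> H w -> H v), H [::],
      (forall w v, H w -> H v -> H (w ++ v)) & (forall w, H w -> H (winv w))].

Definition T_subgroup (H : word -> Prop) : Prop :=
  subgroupF H /\
  forall phi : FreeG -> FreeG, is_hom phi -> forall w, H w -> H (phi w).

Definition trivialT : word -> Prop := fun w => freq w [::].

Definition Fprime : word -> Prop := @derived FreeG (fun _ => True).

Definition FpowN (N : nat) : grp :=
  @Grp ('I_N -> word) (fun x y => forall k, freq (x k) (y k))
       (fun x y k => x k ++ y k) (fun x k => winv (x k)) (fun _ => [::]).

Definition incl (N : nat) (k : 'I_N) (w : word) : FpowN N :=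
  fun j => if j == k then w else [::].

Definition weak_ids (S : word -> Prop) (G : grp) : Prop :=
  exists N, 0 < N /\
    forall s : 'I_N -> word, (forall k, S (s k)) ->
    forall rho : FpowN N -> G, is_hom rho ->
    exists k : 'I_N, geq (rho (incl k (s k))) gone.

Definition verbal (H : word -> Prop) (G : grp) (g : G) : Prop :=
  exists (h : word) (pi : FreeG -> G), H h /\ is_hom pi /\ geq (pi h) g.

Definition quot (G : grp) (K : G -> Prop) : grp :=
  @Grp G (fun x y => K (gmul x (ginv y))) (@gmul G) (@ginv G) (@gone G).

Definition weak_ids_mod (S H : word -> Prop) (G : grp) : Prop :=
  weak_ids S (quot (@verbal H G)).

Definition weak_star_ids_mod (S H : word -> Prop) (G : grp) : Prop :=
  exists (m : nat) (Ss : nat -> word -> Prop),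
    (forall j, j <= m -> T_subgroup (Ss j)) /\
    (forall w, Ss 0 w <-> S w) /\ (forall w, Ss m w <-> H w) /\
    (forall j, 1 <= j <= m -> weak_ids_mod (Ss j.-1) (Ss j) G).

(* Main.v *)
(** For a finitely generated solvable [G], the chain [F', F'', ..., F^(n+1), 1] works: if
    [H_1, ..., H_N] commute pairwise in [G / G^(j+1)] and [N] is large enough, then some [H_k']
    lies in [G''], whence [H_k^(j)] lies in [G^(j+1)].  This only uses the finitely generated
    metabelian group [Q = G / G''], for which one needs a bound on the length of a family of
    pairs [(x_k, y_k)] with [[x_k, y_k] <> 1] and entries of distinct pairs commuting.

    By Hilbert's basis theorem [M = Q'] is a Noetherian module over the group ring of [Q / Q'].
    By Noetherian induction on a submodule [K] the number of [k] with [[x_k, y_k]] not in [K]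
    is bounded.  If [K] is an intersection of two larger submodules, the bounds add up.
    Otherwise, by Fitting's argument, each integer and each [x - 1] is injective or nilpotent
    modulo [K].  As [x_j - 1] kills [[x_k, y_k]] for [j <> k], all [x_j], [y_j] act
    unipotently.  If [Q] is generated by [d] elements, any [d + 1] elements satisfy a
    unimodular relation modulo [Q'], with some exponent injective modulo [K].  Given
    [(d + 1)^2] pairs in [d + 1] blocks, take such a relation between the [x]'s of each block,
    and then one between the [y]'s at the selected positions.  The corresponding two elements
    of the abelian group [Q'] commute, which gives [[x_k^m, y_k^n] = 1] for some [k] and some
    [m], [n] injective modulo [K]; by unipotence [[x_k, y_k]] lies in [K]. *)
From Stdlib Require List.
From mathcomp Require Import all_boot all_algebra.
From mathcomp Require Import boolp.
From HB Require Import structures.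
Require Import Defs.
Set Implicit Arguments. Unset Strict Implicit. Unset Printing Implicit Defensive.
Import GRing.Theory.

(** * Noetherian modules over a commuting family of operators *)

Section Noetherian.
Local Open Scope ring_scope.
Variable M : zmodType.
Implicit Types (W : (M -> M) -> Prop) (A B K : M -> Prop) (f r t : M -> M).

Definition subgroupP K := K 0 /\ forall x y, K x -> K y -> K (x - y).

Definition stable W K :=
  subgroupP K /\ forall f, W f -> forall x, K x -> K (f x).

(** The ascending chain condition for submodules inside [A]. A set [W] of operators stands in for
    the coefficient ring, so that operators can be adjoined one at a time. *)
Definition noeth W A := forall B : nat -> M -> Prop,
  (forall n, stable W (B n)) -> (forall n x, B n x -> A x) ->
  (forall n x, B n x -> B n.+1 x) ->
  exists n, forall k x, (n <= k)%N -> B k x -> B n x.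

Lemma subgroupPN K x : subgroupP K -> K x -> K (- x).
Proof. by move=> [K0 KB] Kx; rewrite -sub0r; apply: KB. Qed.

Lemma subgroupPD K x y : subgroupP K -> K x -> K y -> K (x + y).
Proof.
by move=> sK Kx Ky; rewrite -[y]opprK; apply: sK.2 => //; apply: subgroupPN.
Qed.

Lemma subgroupPDr K x y : subgroupP K -> K (x + y) -> K y -> K x.
Proof. by move=> sK Kxy Ky; rewrite -(addrK y x); apply: sK.2. Qed.

Lemma subgroupPMn K x n : subgroupP K -> K x -> K (x *+ n).
Proof.
move=> sK Kx; elim: n => [|n IH]; first by rewrite mulr0n; case: sK.
by rewrite mulrS; apply: subgroupPD.
Qed.

Lemma subgroupPMz K x (z : int) : subgroupP K -> K x -> K (x *~ z).
Proof.
move=> sK Kx; case: z => n; first exact: subgroupPMn.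
by apply: subgroupPN => //; apply: subgroupPMn.
Qed.

Lemma chain_leq (B : nat -> M -> Prop) :
  (forall n x, B n x -> B n.+1 x) -> forall m n x, (m <= n)%N -> B m x -> B n x.
Proof.
move=> Bi m n x /subnK <-; elim: (n - m)%N => // k IH /IH; rewrite addSn.
exact: Bi.
Qed.

(** A counterexample always has a strictly larger counterexample, and choice strings these into a
    chain that never becomes stationary. *)
Lemma noeth_ind W (P : (M -> Prop) -> Prop) :
  noeth W (fun _ => True) ->
  (forall K, stable W K ->
     (forall K', stable W K' -> (forall x, K x -> K' x) ->
        ~ (forall x, K' x -> K x) -> P K') -> P K) ->
  forall K, stable W K -> P K.
Proof.
move=> nW step K sK; apply: contrapT => nPK.
pose T := {K | stable W K /\ ~ P K}.
have next (k : T) : exists k' : T, (forall x, sval k x -> sval k' x) /\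
    ~ (forall x, sval k' x -> sval k x).
  case: k => k [sk nPk] /=; apply: contrapT => nex; apply: nPk; apply: step => //.
  move=> k' sk' kk' nk'k; apply: contrapT => nPk'; apply: nex.
  by exists (exist _ k' (conj sk' nPk')).
have [g gP] := choice next.
pose B n := iter n g (exist _ K (conj sK nPK) : T).
have [|||n nP] := nW (fun n => sval (B n)).
- by move=> n; case: (B n) => ? [].
- by [].
- by move=> n; apply: (gP _).1.
by apply: (gP (B n)).2 => x; apply: (nP n.+1 x).
Qed.

(** If a positive multiple of [c] occurs in the chain, the least one generates all later terms by
    Euclidean division; otherwise the chain is zero. *)
Lemma noeth_cyclic (c : M) : noeth (fun _ => False) (fun x => exists z : int, x = c *~ z).
Proof.
move=> B sB BA Bi; have Bm := chain_leq Bi.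
have sg n : subgroupP (B n) by case: (sB n).
pose R := fun d => `[< (0 < d)%N /\ exists n, B n (c *+ d) >].
have Babs n z : B n (c *~ z) -> B n (c *+ `|z|%N).
  by case: z => m //= /(subgroupPN (sg n)); rewrite NegzE mulrNz opprK.
have [ex|noR] := pselect (exists d, R d); last first.
  exists 0%N; move=> k x _ Bx; have [z xz] := BA _ _ Bx.
  suff -> : x = 0 by case: (sg 0%N).
  case: (eqVneq z 0) xz => [->|z0] xz; first by rewrite xz mulr0z.
  case: noR; exists `|z|%N; apply/asboolP; split; first by rewrite lt0n absz_eq0.
  by exists k; apply: Babs; rewrite -xz.
case: (ex_minnP ex) => d /asboolP[d0 [n Bn]] dmin.
exists n; move=> k x nk Bx; have [z xz] := BA _ _ Bx.
have zE : z = (z %/ d)%Z * d + (z %% d)%Z := divz_eq z d.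
have Bqd k' : B k' (c *+ d) -> B k' (c *~ ((z %/ d)%Z * d)).
  by move=> H; rewrite mulrC mulrzA; apply: subgroupPMz.
have : B k (c *~ (z %% d)%Z).
  rewrite (_ : _ %% _ = z - (z %/ d)%Z * d)%Z ?mulrzBr -?xz; last first.
    by rewrite [X in X - _]zE addrC addKr.
  by apply: (sg k).2 => //; apply: Bqd; apply: Bm Bn.
have : (0 <= z %% d)%Z by apply: modz_ge0; rewrite -lt0n.
have : (z %% d < d)%Z by apply: ltz_pmod.
case: (z %% d)%Z zE => // e zE; rewrite ltz_nat => ed _ Be.
have [e0|e0] := posnP e; last first.
  suff /dmin : R e by rewrite leqNgt ed.
  by apply/asboolP; split => //; exists k.
by rewrite xz zE e0 addr0; apply: Bqd.
Qed.

Lemma noeth_add W A A' : subgroupP A ->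
  stable W A -> noeth W A -> noeth W A' -> stable W A' ->
  (forall f, W f -> {morph f : x y / x + y}) ->
  noeth W (fun x => exists a b, [/\ A a, A' b & x = a + b]).
Proof.
move=> sA stA nA nA' stA' Wadd B sB BA Bi; have Bm := chain_leq Bi.
have sg n : subgroupP (B n) by case: (sB n).
have sA' := stA'.1.
have [|||n nP] := nA (fun n x => B n x /\ A x).
- move=> n; split; first split.
  + by split; [case: (sg n)|case: sA].
  + by move=> x y [? ?] [? ?]; split; [apply: (sg n).2|apply: sA.2].
  + by move=> f Wf x [? ?]; split; [apply: (sB n).2|apply: stA.2].
- by move=> n x [].
- by move=> n x [? ?]; split => //; apply: Bi.
(* The second chain is the image of [B n] modulo [A], represented by elements of [A']. *)
have [|||n' n'P] := nA' (fun n y => A' y /\ exists2 a, A a & B n (a + y)).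
- move=> n0; split; first split.
  + by split; [case: sA'|exists 0; [case: sA|rewrite addr0; case: (sg n0)]].
  + move=> x y [? [a Aa Ba]] [? [b Ab Bb]]; split; first exact: sA'.2.
    exists (a - b); first exact: sA.2.
    by rewrite addrACA -opprD; apply: (sg n0).2.
  + move=> f Wf x [? [a Aa Ba]]; split; first exact: stA'.2.
    by exists (f a); [apply: stA.2|rewrite -Wadd //; apply: (sB n0).2].
- by move=> n0 x [].
- by move=> n0 x [? [a Aa Ba]]; split => //; exists a => //; apply: Bi.
exists (maxn n n'); move=> k x; rewrite geq_max => /andP[nk n'k] Bx.
have [a [b [Aa Ab xE]]] := BA _ _ Bx.
have [|_ [a' Aa' Ba']] := n'P k b n'k; first by split => //; exists a; rewrite -?xE.
have {}Ba' : B (maxn n n') (a' + b) by apply: Bm Ba'; rewrite leq_maxr.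
have [|Baa _] := nP k (a - a') nk.
  split; last exact: sA.2.
  have -> : a - a' = x - (a' + b) by rewrite xE opprD addrACA subrr addr0.
  by apply: (sg k).2 => //; apply: Bm Ba'; rewrite geq_max nk.
have -> : x = (a - a') + (a' + b) by rewrite addrA subrK.
by apply: subgroupPD => //; apply: Bm Baa; rewrite leq_maxl.
Qed.

(** The values at [t] of the polynomials of degree less than [i] with coefficients in [A]; the
    outermost summand is the leading term. *)
Fixpoint poly_span t A i : M -> Prop :=
  if i is i.+1 then fun x => exists a b, [/\ A a, poly_span t A i b & x = iter i t a + b]
  else fun x => x = 0.

Section PolySpan.
Variables (W : (M -> M) -> Prop) (A : M -> Prop) (t : M -> M).
Hypotheses (stA : stable W A) (Wadd : forall f, W f -> {morph f : x y / x + y})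
  (tadd : {morph t : x y / x + y}) (tW : forall f, W f -> forall x, t (f x) = f (t x)).

Lemma morphD0 f : {morph f : x y / x + y} -> f 0 = 0.
Proof. by move=> fD; apply: (@addIr _ (f 0)); rewrite -fD !add0r. Qed.

Lemma morphDB f : {morph f : x y / x + y} -> {morph f : x y / x - y}.
Proof. by move=> fD x y; apply: (@addIr _ (f y)); rewrite -fD !subrK. Qed.

Lemma iter_morphD n : {morph iter n t : x y / x + y}.
Proof. by elim: n => // n IH x y; rewrite !iterS IH tadd. Qed.

Lemma iter_commute f n x : W f -> iter n t (f x) = f (iter n t x).
Proof. by move=> Wf; elim: n => //= n ->; rewrite tW. Qed.

Lemma poly_span_stable i : stable W (poly_span t A i).
Proof.
elim: i => [|i [[IH0 IHB] IHW]].
  split; first by split=> // x y -> ->; rewrite subrr.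
  by move=> f Wf x -> /=; apply: morphD0; apply: Wadd.
split; first split.
- exists 0, 0; split => //; first by case: stA => -[].
  by rewrite addr0 morphD0 //; apply: iter_morphD.
- move=> _ _ [a [b [Aa Sb ->]]] [a' [b' [Aa' Sb' ->]]].
  exists (a - a'), (b - b'); split; [exact: stA.1.2|exact: IHB|].
  by rewrite (morphDB (@iter_morphD i)) opprD addrACA.
- move=> f Wf _ [a [b [Aa Sb ->]]]; exists (f a), (f b).
  by split; [exact: stA.2|exact: IHW|rewrite Wadd // iter_commute].
Qed.

Lemma poly_span_shift i x : poly_span t A i x -> poly_span t A i.+1 (t x).
Proof.
elim: i x => [|i IH] x.
  move=> /= ->; exists 0, 0; split => //; first by case: stA => -[].
  by rewrite /= morphD0 // addr0.
by move=> [a [b [Aa Sb ->]]]; exists a, (t b); split; [|exact: IH|rewrite tadd].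
Qed.

Lemma poly_span_succ i x : poly_span t A i x -> poly_span t A i.+1 x.
Proof.
move=> Sx; exists 0, x; split => //; first by case: stA => -[].
by rewrite morphD0 ?add0r //; apply: iter_morphD.
Qed.

Definition poly_ext x := exists i, poly_span t A i x.

Lemma sub_poly_ext x : A x -> poly_ext x.
Proof. by move=> Ax; exists 1%N, x, 0; split => //=; rewrite addr0. Qed.

Lemma poly_ext_stable : stable (fun f => t = f \/ W f) poly_ext.
Proof.
have le := chain_leq poly_span_succ.
split; first split.
- by exists 0%N.
- move=> x y [i Si] [j Sj]; exists (maxn i j).
  by apply: (poly_span_stable _).1.2; [apply: le Si; apply: leq_maxl|apply: le Sj; apply: leq_maxr].
- move=> f Wf x [i Si]; case: Wf => [<-|Wf].
    by exists i.+1; apply: poly_span_shift.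
  by exists i; apply: (poly_span_stable i).2.
Qed.

(* Hilbert's basis theorem: a chain of submodules of [poly_ext] is governed by the doubly
   indexed family of the submodules [L n i] of leading coefficients in degree [i]. *)
Lemma noeth_poly_ext : noeth W A -> noeth (fun f => t = f \/ W f) poly_ext.
Proof.
move=> nA B sB BA Bi; have Bm := chain_leq Bi.
have sg n : subgroupP (B n) by case: (sB n).
have sgA := stA.1.
pose L n i a := A a /\ exists2 b, poly_span t A i b & B n (iter i t a + b).
have stL n i : stable W (L n i).
  have [[S0 SB] SW] := poly_span_stable i.
  split; first split.
  - split; first by case: sgA.
    exists 0 => //; rewrite addr0 morphD0; last exact: iter_morphD.
    by case: (sg n).
  - move=> a a' [Aa [b Sb Bb]] [Aa' [b' Sb' Bb']]; split; first exact: sgA.2.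
    exists (b - b'); first exact: SB.
    by rewrite (morphDB (@iter_morphD i)) addrACA -opprD; apply: (sg n).2.
  - move=> f Wf a [Aa [b Sb Bb]]; split; first exact: stA.2.
    exists (f b); first exact: SW.
    by rewrite iter_commute // -Wadd //; apply: (sB n).2 => //; right.
have Ln n i a : L n i a -> L n.+1 i a.
  by move=> [Aa [b Sb Bb]]; split => //; exists b => //; apply: Bi.
have Li n i a : L n i a -> L n i.+1 a.
  move=> [Aa [b Sb Bb]]; split => //; exists (t b); first exact: poly_span_shift.
  by rewrite /= -tadd; apply: (sB n).2 => //; left.
have LA n i a : L n i a -> A a by case.
have Lnm i := @chain_leq (L^~ i) (fun n => @Ln n i).
have Lim n := @chain_leq (L n) (@Li n).
(* [L n i] grows in both indices, so the diagonal chain [L n n] becomes stationary at some [p],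
   which controls all degrees from [p] on. *)
have [|||p pP] := nA (fun n => L n n) => //.
- by move=> n x; apply: LA.
- by move=> n x /Ln /Li.
have col i : exists n, forall k x, (n <= k)%N -> L k i x -> L n i x.
  by apply: nA => // n x; [apply: LA|apply: Ln].
have [q qP] := choice col.
(* Only finitely many degrees lie below [p], and each has its own stationary index [q i]. *)
pose Q := maxn p (\max_(i < p) q i).
have QP k i x : (Q <= k)%N -> L k i x -> L Q i x.
  rewrite geq_max => /andP[pk qk] Lx; have [ip|pi] := ltnP i p.
    apply: (Lnm i (q i)); last first.
      by apply: qP Lx; apply: leq_trans qk; apply: (leq_bigmax (Ordinal ip)).
    by apply: leq_trans (leq_maxr _ _); apply: (leq_bigmax (Ordinal ip)).
  apply: (Lnm i p); first exact: leq_maxl.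
  apply: (Lim p p) => //; apply: (pP (maxn k i)); first by rewrite leq_max pk.
  apply: (Lim _ i); first exact: leq_maxr.
  by apply: (Lnm i k) => //; apply: leq_maxl.
exists Q; move=> k x Qk Bx; have [i Si] := BA _ _ Bx.
elim: i x Si Bx => [|i IH] x Si Bx; first by rewrite Si; case: (sg Q).
case: Si => a [b [Aa Sb xE]].
have [|_ [b' Sb' Bb']] := QP k i a Qk; first by split => //; exists b; rewrite -?xE.
(* Subtracting an element of [B Q] with the same leading coefficient leaves [b - b'], of lower
   degree, to the induction. *)
have -> : x = (iter i t a + b') + (b - b') by rewrite addrCA addrK addrC.
apply: subgroupPD => //; apply: IH; first exact: (poly_span_stable i).1.2.
have -> : b - b' = x - (iter i t a + b') by rewrite xE opprD addrACA subrr add0r.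
by apply: (sg k).2 => //; apply: Bm Bb'.
Qed.

End PolySpan.

Lemma stable0 W : (forall f, W f -> {morph f : x y / x + y}) ->
  stable W (fun x => x = 0).
Proof.
move=> Wadd; split; first by split=> // x y -> ->; rewrite subrr.
by move=> f /Wadd fD x ->; apply: morphD0.
Qed.

Lemma noeth_fin_gen (C : seq M) : exists A, [/\ stable (fun _ => False) A,
  noeth (fun _ => False) A & forall c, List.In c C -> A c].
Proof.
elim: C => [|c C [A [sA nA CA]]].
  exists (fun x => x = 0); split => //; first exact: stable0.
  by move=> B sB BA _; exists 0%N => k x _ /BA ->; case: (sB 0%N) => -[].
have sc : stable (fun _ => False) (fun x => exists z : int, x = c *~ z).
  split=> //; split; first by exists 0; rewrite mulr0z.
  by move=> _ _ [z ->] [z' ->]; exists (z - z'); rewrite mulrzBr.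
exists (fun x => exists a b, [/\ (exists z : int, a = c *~ z), A b & x = a + b]).
split.
- split=> //; split.
    by exists 0, 0; split; [exists 0; rewrite mulr0z|case: sA => -[]|rewrite addr0].
  move=> _ _ [a [b [ca Ab ->]]] [a' [b' [ca' Ab' ->]]].
  exists (a - a'), (b - b'); split; [exact: sc.1.2|exact: sA.1.2|].
  by rewrite opprD addrACA.
- by apply: noeth_add => //; [case: sc|exact: noeth_cyclic].
- move=> x [<-|/CA Ax].
    by exists c, 0; split; [exists 1|case: sA => -[]|rewrite addr0].
  by exists 0, x; split; [exists 0; rewrite mulr0z| |rewrite add0r].
Qed.

(** Hilbert's theorem is applied once per operator, starting from a Noetherian subgroup that
    contains [C]. *)
Lemma noeth_ops (fs : seq (M -> M)) (C : seq M) :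
  (forall f, List.In f fs -> {morph f : x y / x + y}) ->
  (forall f g, List.In f fs -> List.In g fs -> forall x, f (g x) = g (f x)) ->
  exists A, [/\ stable (fun f => List.In f fs) A,
    noeth (fun f => List.In f fs) A & forall c, List.In c C -> A c].
Proof.
elim: fs => [|t fs IH] fsD fsC; first exact: noeth_fin_gen.
have fsD' f : List.In f fs -> {morph f : x y / x + y} by move=> ?; apply: fsD; right.
have tfs f : List.In f fs -> forall x, t (f x) = f (t x).
  by move=> ?; apply: fsC; [left|right].
have tD : {morph t : x y / x + y} by apply: fsD; left.
have [//|f g ? ?|A [sA nA CA]] := IH; first by apply: fsC; right.
exists (poly_ext A t); split; first exact: poly_ext_stable.
  exact: noeth_poly_ext.
by move=> c /CA; apply: sub_poly_ext.
Qed.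

(** * Irreducible submodules *)

Section Primary.
Variables (W : (M -> M) -> Prop) (K : M -> Prop) (r : M -> M).
Hypotheses (Wadd : forall f, W f -> {morph f : x y / x + y})
  (nW : noeth W (fun _ => True)) (sK : stable W K)
  (rD : {morph r : x y / x + y}) (rW : forall f, W f -> forall x, r (f x) = f (r x))
  (rK : forall x, K x -> K (r x)).

Definition irreducible_mod := forall K1 K2,
  stable W K1 -> stable W K2 ->
  (forall x, K x -> K1 x) -> (forall x, K x -> K2 x) ->
  (forall x, K1 x -> K2 x -> K x) ->
  (forall x, K1 x -> K x) \/ (forall x, K2 x -> K x).

(* Fitting: when the kernels of the powers of [r] modulo [K] stabilise at [n], the
   kernel and the image of [r ^ n] meet in [K]. *)
Lemma irreducible_primary : irreducible_mod ->
  (forall x, K (r x) -> K x) \/ (exists n, forall x, K (iter n r x)).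
Proof.
move=> irr; have sgK := sK.1.
have rn n := iter_morphD rD n.
have rnK n x : K x -> K (iter n r x) by elim: n => //= n IH /IH; apply: rK.
have rnW n f x : W f -> iter n r (f x) = f (iter n r x) by apply: iter_commute.
have sker n : stable W (fun x => K (iter n r x)).
  split; first split.
  - by apply: rnK; case: sgK.
  - by move=> x y Kx Ky; rewrite (morphDB (rn n)); apply: sgK.2.
  - by move=> f Wf x Kx; rewrite rnW //; apply: sK.2.
have [n x|n nP] := @nW _ sker (fun _ _ _ => I); [exact: rK|].
(* [K2] is [K] plus the image of the power [n.+1] of [r]. The exponent must be positive, since at
   the end the kernel of [r] modulo [K] has to lie in that of the power. *)
pose K2 y := exists x, K (y - iter n.+1 r x).
have sK2 : stable W K2.
  split; first split.
  - by exists 0; rewrite (morphD0 (rn n.+1)) subr0; case: sgK.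
  - move=> y y' [x Kx] [x' Kx']; exists (x - x').
    rewrite (morphDB (rn n.+1)) opprB addrACA [- y' + _]addrC -addrACA -(opprB y').
    exact: sgK.2.
  - move=> f Wf y [x Kx]; exists (f x).
    by rewrite rnW // -(morphDB (Wadd Wf)); apply: sK.2.
case: (irr _ _ (sker n.+1) sK2).
- by move=> x; apply: rnK.
- by move=> x Kx; exists 0; rewrite (morphD0 (rn n.+1)) subr0.
- move=> x K1x [y Ky].
  apply: (subgroupPDr (y := - iter n.+1 r y)) => //; apply: subgroupPN => //.
  apply: rK; apply: (nP (n.+1 + n.+1)%N).
    by rewrite (leq_trans (leqnSn n)) // leq_addr.
  rewrite iterD; apply: (subgroupPDr (y := iter n.+1 r (x - iter n.+1 r y))) => //.
    by rewrite -(rn n.+1) addrCA subrr addr0.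
  exact: rnK.
- move=> H; left => x Krx; apply: H; rewrite iterSr; exact: rnK.
- move=> H; right; exists n.+1 => x; apply: H; exists x; rewrite subrr.
  by case: sgK.
Qed.

(** The first iterate of [z] inside [K] comes right after the wanted one. *)
Lemma nilpotent_annihilated n z : (forall x, K (iter n r x)) -> ~ K z ->
  exists h, ~ K (iter h r z) /\ K (r (iter h r z)).
Proof.
move=> nil nKz; have ex : exists m, `[< K (iter m r z) >].
  by exists n; apply/asboolP.
case: (ex_minnP ex) => -[/asboolP//|m] /asboolP Km mmin; exists m; split => // Kz.
by have := mmin m (asboolT Kz); rewrite ltnn.
Qed.

End Primary.
End Noetherian.

(** * Finitely generated metabelian groups *)

(** In the Smith form, a diagonal [d.+1] by [d] matrix has zero last row, so the last row of the
    inverse of the left factor [L] kills [V]; the last column of [L] shows that this row is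
    unimodular. *)
Lemma int_unimodular_relation d (V : 'M[int]_(d.+1, d)) :
  exists (m : 'rV[int]_d.+1) (u : 'cV[int]_d.+1),
    (m *m V = 0)%R /\ (m *m u = 1%:M)%R.
Proof.
have [L uL [R _ [e _ ->]]] := int_Smith_normal_form V.
exists (row ord_max (invmx L)), (col ord_max L); split.
  rewrite -row_mul mulmxA mulKmx // row_mul.
  suff -> : (row ord_max (\matrix_(i < d.+1, j < d) (e`_i *+ (i == j :> nat))) = 0)%R.
    by rewrite mul0mx.
  apply/rowP=> j; rewrite !mxE /=.
  by rewrite gtn_eqF //.
apply/matrixP=> i j; rewrite !ord1.
have /matrixP/(_ ord_max ord_max) := mulVmx uL; rewrite !mxE !eqxx => <-.
by apply: eq_bigr => k _; rewrite !mxE.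
Qed.

Local Open Scope group_scope.

(** The elements of [Q] are the classes of [geq], encoded as predicates, with representatives picked
    by choice. This turns setoid equality into equality and opens up the theory of [groupType]. *)
Lemma quotient_group (G : grp) : is_group G ->
  exists (Q : groupType) (p : G -> Q),
    [/\ forall x y, p x = p y <-> geq x y,
        forall x y, p (gmul x y) = p x * p y & forall z, exists x, p x = z].
Proof.
move=> [gr [gs [gt [gm [gi [ga [g1 gV]]]]]]].
pose T : Type := {P : G -> Prop | exists x, P = geq x}.
pose p x : T := exist _ (geq x) (ex_intro _ x erefl).
have pE x y : p x = p y <-> geq x y.
  split=> [[] /(congr1 (fun P => P y)) -> //|xy].
  apply: eq_exist => /=; apply/funext => z; apply: propext.
  by split; apply: gt => //; apply: gs.
have /choice[s sK] (z : T) : exists x, p x = z.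
  by case: z => P [x xP]; exists x; apply: eq_exist; rewrite xP.
pose TC : choiceType := {classic T}.
pose mul (a b : TC) : TC := p (gmul (s a) (s b)).
pose inv (a : TC) : TC := p (ginv (s a)).
have mA : associative mul.
  move=> a b c; apply/pE; apply: (gt _ (gmul (s a) (gmul (s b) (s c)))).
    by apply: gm => //; apply/pE; rewrite sK.
  apply: (gt _ _ _ (ga _ _ _)); apply: gm => //; apply: gs.
  by apply/pE; rewrite sK.
have m1 : left_id (p gone : TC) mul.
  move=> a; rewrite -[RHS]sK; apply/pE; apply: (gt _ (gmul gone (s a))) => //.
  by apply: gm => //; apply/pE; rewrite sK.
have mV : left_inverse (p gone : TC) inv mul.
  move=> a; apply/pE; apply: (gt _ (gmul (ginv (s a)) (s a))) => //.
  by apply: gm => //; apply/pE; rewrite sK.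
have mVr : right_inverse (p gone : TC) inv mul.
  move=> a; rewrite -[LHS]m1 -{1}(mV (inv a)) -mA (mA (inv a)).
  by rewrite mV m1; apply: mV.
have m1r : right_id (p gone : TC) mul.
  by move=> a; rewrite -{1}(mV a) mA mVr; apply: m1.
pose Q := HB.pack_for groupType TC (isGroup.Build TC mA m1 m1r mV mVr).
exists Q, p; split=> // [x y|z]; last by exists (s z).
by apply/pE; apply: gm; apply/pE; rewrite sK.
Qed.

Lemma commutative_zmod (Q : groupType) : (forall x y : Q, commute x y) ->
  exists (Z : zmodType) (f : Q -> Z) (g : Z -> Q),
    [/\ cancel f g, cancel g f & forall x y, f (x * y) = (f x + f y)%R].
Proof.
move=> QC.
pose Z := HB.pack_for zmodType Q
  (GRing.isZmodule.Build Q (@mulgA Q) QC (@mul1g Q) (@mulVg Q)).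
by exists Z, id, id.
Qed.

(** * Derived subgroup, abelianization and integral relations *)

Section DerivedSubgroup.
Variable Q : groupType.
Implicit Types x y : Q.

(** The smallest subgroup containing all commutators, encoded by its induction principle. *)
Definition der x := forall P : Q -> Prop, P 1 -> (forall x y, P x -> P y -> P (x * y)) ->
  (forall x, P x -> P x^-1) -> (forall x y, P [~ x, y]) -> P x.

Lemma der1 : der 1.
Proof. by move=> P. Qed.

Lemma derM x y : der x -> der y -> der (x * y).
Proof. by move=> dx dy P P1 PM PV PR; apply: (PM); [exact: dx|exact: dy]. Qed.

Lemma derV x : der x -> der x^-1.
Proof. by move=> dx P P1 PM PV PR; apply: (PV); exact: dx. Qed.

Lemma derR x y : der [~ x, y].
Proof. by move=> P _ _ _ PR; exact: PR. Qed.

Lemma derJ x y : der x -> der (x ^ y).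
Proof.
move=> dx; have -> : x ^ y = x * [~ x, y] by rewrite commgEl mulVKg.
by apply: derM => //; apply: derR.
Qed.

Lemma abelianization : exists (Z : zmodType) (f : Q -> Z),
  (forall x y, f (x * y) = (f x + f y)%R) /\ (forall x, f x = 0%R -> der x).
Proof.
pose H := @Grp Q (fun x y => der (x / y)) (fun x y => x * y) (fun x => x^-1) 1.
have gH : is_group H.
  split; [|split; [|split; [|split; [|split; [|split; [|split]]]]]] => /=.
  - by move=> x; rewrite mulgV; apply: der1.
  - by move=> x y /derV; rewrite invgF.
  - by move=> x y z dx dy; rewrite -(divgKA y); apply: derM.
  - move=> x x' y y' dx dy.
    have -> : x * y / (x' * y') = (y / y') ^ x^-1 * (x / x').
      by rewrite conjgE invgM invgK !mulgA mulgVK.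
    by apply: derM => //; apply: derJ.
  - move=> x y dx; have -> : x^-1 / y^-1 = (y / x) ^ x.
      by rewrite conjgE invgK !mulgA mulgVK.
    by apply: derJ; rewrite -invgF; apply: derV.
  - by move=> x y z; rewrite mulgA mulgV; apply: der1.
  - by move=> x; rewrite mul1g mulgV; apply: der1.
  - by move=> x; rewrite mulVg mulgV; apply: der1.
have [A [p [pE pM pS]]] := quotient_group gH.
have [|Z [f [f' [fK f'K fM]]]] := @commutative_zmod A.
  move=> a b; have [x <-] := pS a; have [y <-] := pS b.
  rewrite /commute -!pM; apply/pE => /=.
  have -> : x * y / (y * x) = [~ x^-1, y^-1] by rewrite commgEl conjgE invgM !invgK !mulgA.
  exact: derR.
exists Z, (f \o p); split=> [x y|x /= fx0]; first by rewrite /= -fM -pM.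
have p1 : p 1 = 1 by apply: (@mulgI _ (p 1)); rewrite -pM /= !mulg1.
have : p x = p 1.
  apply: (can_inj fK); rewrite fx0 p1; apply: (@addrI _ (f 1)).
  by rewrite -fM mulg1 addr0.
by move/pE => /=; rewrite divg1.
Qed.

Lemma derived_zmod : (forall x y, der x -> der y -> commute x y) ->
  exists (M : zmodType) (i : M -> Q), [/\ injective i,
    forall a b, i (a + b)%R = i a * i b, forall a, der (i a) &
    forall x, der x -> exists a, i a = x].
Proof.
move=> QM.
pose T := {x | der x}.
pose mul (a b : T) : T := exist _ (sval a * sval b) (derM (svalP a) (svalP b)).
pose inv (a : T) : T := exist _ (sval a)^-1 (derV (svalP a)).
pose H := @Grp T (fun a b => sval a = sval b) mul inv (exist _ 1 der1).
have gH : is_group H.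
  split; [|split; [|split; [|split; [|split; [|split; [|split]]]]]] => //=.
  - by move=> a b c ->.
  - by move=> a a' b b' -> ->.
  - by move=> a a' ->.
  - by move=> a b c; rewrite mulgA.
  - by move=> a; rewrite mul1g.
  - by move=> a; rewrite mulVg.
have [A [p [pE pM pS]]] := quotient_group gH.
have [|Z [f [f' [fK f'K fM]]]] := @commutative_zmod A.
  move=> a b; have [x <-] := pS a; have [y <-] := pS b.
  by rewrite /commute -!pM; apply/pE => /=; apply: QM; apply: svalP.
have /choice[s sE] (z : Z) : exists a, f (p a) = z.
  by have [a pa] := pS (f' z); exists a; rewrite pa.
exists Z, (fun z => sval (s z)); split.
- by move=> a b /pE ab; rewrite -(sE a) -(sE b) ab.
- move=> a b; apply: (pE (s (a + b)%R) (mul (s a) (s b))).1.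
  by apply: (can_inj fK); rewrite sE (pM (s a)) fM !sE.
- by move=> a; apply: svalP.
- move=> x dx; exists (f (p (exist _ x dx))).
  have /pE -> // : p (s (f (p (exist _ x dx)))) = p (exist _ x dx).
  by apply: (can_inj fK); rewrite sE.
Qed.

Definition zexpg x (m : int) : Q := if m is Posz n then x ^+ n else x ^- (`|m|%N).

Lemma zexpg_additive (Z : zmodType) (f : Q -> Z) x m :
  (forall x y, f (x * y) = (f x + f y)%R) -> f (zexpg x m) = (f x *~ m)%R.
Proof.
move=> fM; have f1 : f 1 = 0%R by apply: (@addrI _ (f 1)); rewrite -fM mulg1 addr0.
have fX n : f (x ^+ n) = (f x *+ n)%R.
  by elim: n => [|n IH]; rewrite ?mulr0n // expgS fM IH mulrS.
case: m => n /=; first exact: fX.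
apply: (@addrI _ (f (x ^+ n.+1))); rewrite -fM mulgV f1 NegzE mulrNz fX.
by rewrite subrr.
Qed.

Lemma commute_zexpg x y m : commute x y -> commute x (zexpg y m).
Proof. by move=> xy; case: m => n; [|apply: commuteV]; apply: commuteX. Qed.

Lemma commute_absz x y m : commute x (zexpg y m) -> commute x (y ^+ `|m|).
Proof. by case: m => //= n /commuteV; rewrite invgK. Qed.

Definition generates d (g : 'I_d -> Q) := forall P : Q -> Prop, P 1 ->
  (forall k x, P x -> P (g k * x)) -> (forall k x, P x -> P ((g k)^-1 * x)) ->
  forall x, P x.

Lemma generates_additive d (g : 'I_d -> Q) (Z : zmodType) (f : Q -> Z) :
  generates g -> (forall x y, f (x * y) = (f x + f y)%R) ->
  forall x, exists v : 'I_d -> int, f x = (\sum_k f (g k) *~ v k)%R.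
Proof.
move=> gen fM; have f1 : f 1 = 0%R by apply: (@addrI _ (f 1)); rewrite -fM mulg1 addr0.
have fV x : f x^-1 = (- f x)%R by apply: (@addrI _ (f x)); rewrite -fM mulgV f1 subrr.
have step k (e : int) (v : 'I_d -> int) :
    (f (g k) *~ e + \sum_l f (g l) *~ v l =
     \sum_l f (g l) *~ (v l + (if l == k then e else 0)))%R.
  rewrite [RHS](eq_bigr _ (fun l _ => mulrzDr _ _ _)) big_split /= addrC.
  congr (_ + _)%R; rewrite (bigD1 k) //= eqxx big1 ?addr0 // => l /negPf ->.
  by rewrite mulr0z.
elim/gen.
- by exists (fun _ => 0%R); rewrite f1 big1.
- move=> k x [v fx]; exists (fun l => v l + (if l == k then 1 else 0))%R.
  by rewrite -step fM fx.
- move=> k x [v fx]; exists (fun l => v l + (if l == k then -1 else 0))%R.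
  by rewrite -step fM fV fx mulrNz.
Qed.

(** Over the [d] generators of the abelianization, the exponent vectors of the [x j] are [d.+1] rows
    of length [d], so [int_unimodular_relation] applies. *)
Lemma derived_relation d (g : 'I_d -> Q) : generates g -> forall x : 'I_d.+1 -> Q,
  exists m u : 'I_d.+1 -> int,
    (\sum_j m j * u j = 1)%R /\ der (\prod_j zexpg (x j) (m j)).
Proof.
move=> gen x; have [Z [f [fM f0]]] := abelianization.
have /choice[v vE] j := generates_additive gen fM (x j).
have [m [u [mv mu]]] := int_unimodular_relation (\matrix_(j, k) v j k).
exists (fun j => m ord0 j), (fun j => u j ord0); split.
  by move/matrixP/(_ ord0 ord0): mu; rewrite !mxE eqxx.
have f1 : f 1 = 0%R by apply: (@addrI _ (f 1)); rewrite -fM mulg1 addr0.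
apply: f0; rewrite (big_morph f fM f1).
under eq_bigr => j _ do rewrite zexpg_additive // vE mulrz_suml.
rewrite exchange_big /= big1 // => k _.
under eq_bigr => j _ do rewrite -mulrzA mulrC.
rewrite -mulrz_sumr.
have /matrixP/(_ ord0 k) := mv; rewrite !mxE.
by under eq_bigr => j _ do rewrite mxE; move=> ->; rewrite mulr0z.
Qed.

End DerivedSubgroup.

Lemma commMgJ (Q : groupType) (x y z : Q) : [~ x * y, z] = [~ x, z] ^ y * [~ y, z].
Proof. by rewrite !commgEr !conjgE !invgM !mulgA !mulgK. Qed.

(** The other factors commute with [v] and are cancelled from the product one after the other. *)
Lemma commute_prod_factor (Q : groupType) (J : eqType) (s : seq J) (F : J -> Q) v j0 :
  uniq s -> j0 \in s -> (forall j, j != j0 -> commute v (F j)) ->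
  commute v (\prod_(j <- s) F j) -> commute v (F j0).
Proof.
move=> us js vF; elim: s us js => //= j s IH /andP[js us].
rewrite inE big_cons; have [j0j _ vs|jj0 /= j0s vs] := eqVneq j0 j.
  rewrite j0j -[F j](mulgK (\prod_(l <- s) F l)); apply: commuteM => //.
  apply: commuteV; rewrite big_seq; apply: commute_prod => l ls; apply: vF.
  by rewrite j0j; apply: contraNneq js => <-.
apply: IH => //; rewrite -(mulKg (F j) (\prod_(l <- s) F l)).
by apply: commuteM => //; apply: commuteV; apply: vF; rewrite eq_sym.
Qed.

(** * The derived subgroup of a metabelian group as a module *)

Section MetabelianModule.
Variables (Q : groupType) (d : nat) (g : 'I_d -> Q) (M : zmodType) (emb : M -> Q)
  (act : Q -> M -> M) (c : Q -> Q -> M).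
Hypotheses (gen : generates g) (QM : forall x y : Q, der x -> der y -> commute x y)
  (emb_inj : injective emb) (embD : forall a b, emb (a + b)%R = emb a * emb b)
  (emb_der : forall a, der (emb a)) (emb_act : forall x a, emb (act x a) = emb a ^ x)
  (emb_c : forall x y, emb (c x y) = [~ x, y]).
Implicit Types (x y : Q) (a b : M) (K : M -> Prop).

Lemma emb0 : emb 0%R = 1.
Proof. by apply: (@mulgI _ (emb 0%R)); rewrite -embD addr0 mulg1. Qed.

Lemma embN a : emb (- a)%R = (emb a)^-1.
Proof. by apply: (@mulgI _ (emb a)); rewrite -embD subrr emb0 mulgV. Qed.

Lemma c_eq0 x y : commute x y -> c x y = 0%R.
Proof. by move/commgP/eqP=> cxy; apply: emb_inj; rewrite emb_c cxy emb0. Qed.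

Lemma c_swap x y : c y x = (- c x y)%R.
Proof. by apply: emb_inj; rewrite embN !emb_c invgR. Qed.

Lemma actD x : {morph act x : a b / (a + b)%R}.
Proof. by move=> a b; apply: emb_inj; rewrite emb_act !embD !emb_act conjMg. Qed.

Lemma act1 a : act 1 a = a.
Proof. by apply: emb_inj; rewrite emb_act conjg1. Qed.

Lemma actM x y a : act (x * y) a = act y (act x a).
Proof. by apply: emb_inj; rewrite !emb_act conjgM. Qed.

(** [x * y] and [y * x] differ by a commutator, which centralises the abelian group [Q']; the action
    thus factors through the abelianization. *)
Lemma actC x y a : act x (act y a) = act y (act x a).
Proof.
rewrite -!actM commgC actM; apply: emb_inj; rewrite emb_act; apply/conjg_fixP/commgP.
by apply: QM; [exact: emb_der|exact: derR].
Qed.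

Lemma act_fix x y z : commute x y -> commute x z -> act x (c y z) = c y z.
Proof.
move=> xy xz; apply: emb_inj; rewrite emb_act emb_c; apply/conjg_fixP/commgP.
by apply: commute_sym; do !apply: commuteM => //; apply: commuteV.
Qed.

Lemma c_mul x y z : c (x * y) z = (act y (c x z) + c y z)%R.
Proof. by apply: emb_inj; rewrite embD emb_act !emb_c commMgJ. Qed.

(** Inverses are included so that the stable subgroups are the submodules over the whole group
    ring. *)
Definition op (f : M -> M) := exists k, f = act (g k) \/ f = act (g k)^-1.

Lemma op_act f : op f -> exists x, f = act x.
Proof. by case=> k [->|->]; eexists. Qed.

Lemma opD f : op f -> {morph f : a b / (a + b)%R}.
Proof. by move=> /op_act[x ->]; apply: actD. Qed.

Lemma stable_act K x a : stable op K -> K a -> K (act x a).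
Proof.
move=> sK; elim/gen: x a => [a|k x IH a|k x IH a]; rewrite ?act1 // actM => Ka.
  by apply: IH; apply: sK.2 => //; exists k; left.
by apply: IH; apply: sK.2 => //; exists k; right.
Qed.

(** [c] is a crossed homomorphism in its first argument by [c_mul] and antisymmetric by [c_swap], so
    membership in [K] spreads from the generators to one argument and then to the other. *)
Lemma c_generators K : stable op K -> (forall k l, K (c (g k) (g l))) ->
  forall x y, K (c x y).
Proof.
move=> sK Kg; have sg := sK.1.
have ext y : (forall k, K (c (g k) y)) -> forall x, K (c x y).
  move=> Ky; elim/gen => [|k x Kx|k x Kx].
  - by rewrite c_eq0; [case: sg|exact/commute_sym/commute1].
  - by rewrite c_mul; apply: subgroupPD => //; apply: stable_act.
  - rewrite c_mul; apply: subgroupPD => //; apply: stable_act => //.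
    (* For an inverse, expand [c (g k * (g k)^-1) y], which is zero. *)
    apply: (subgroupPDr (y := act (g k)^-1 (c (g k) y))) => //; last exact: stable_act.
    rewrite addrC -c_mul mulgV c_eq0; [by case: sg|exact/commute_sym/commute1].
move=> x y; apply: (ext y) => k; rewrite c_swap; apply: subgroupPN => //.
by apply: ext => l; apply: Kg.
Qed.

(** By [c_generators], the finitely many commutators of generators span [Q'] as a module; the
    operators are finitely many and commute, so [noeth_ops] applies. *)
Lemma derived_noeth : noeth op (fun _ => True).
Proof.
have InP (T : eqType) (T' : Type) (F : T -> T') s z :
    List.In z (map F s) <-> exists2 k, k \in s & z = F k.
  elim: s => [|k s IH] /=; first by split=> // -[].
  rewrite IH; split=> [[<-|[l ls ->]]|[l]]; first by exists k; rewrite ?mem_head.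
    by exists l; rewrite // inE ls orbT.
  by rewrite inE => /predU1P[->|ls] ->; [left|right; exists l].
pose D (k : 'I_d + 'I_d) :=
  match k with inl k => act (g k) | inr k => act (g k)^-1 end.
pose fs := map D (enum {: 'I_d + 'I_d}).
have opE f : List.In f fs <-> op f.
  rewrite InP; split=> [[[k|k] _ ->]|[k [->|->]]].
  - by exists k; [left].
  - by exists k; right.
  - by exists (inl k); rewrite ?mem_enum.
  - by exists (inr k); rewrite ?mem_enum.
have {}opE : (fun f => List.In f fs) = op by apply/funext => f; apply/propext.
have [|f f'|A []] := @noeth_ops M fs
  (map (fun k : 'I_d * 'I_d => c (g k.1) (g k.2)) (enum {: 'I_d * 'I_d})).
- by move=> f; rewrite -[List.In _ _]/((fun f => List.In f fs) f) opE; apply: opD.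
- rewrite -[List.In f _]/((fun f => List.In f fs) f).
  rewrite -[List.In f' _]/((fun f => List.In f fs) f') opE.
  by move=> /op_act[x ->] /op_act[y ->]; apply: actC.
rewrite opE => sA nA CA.
(* The image of [A] under [emb] is a subgroup containing every commutator, hence all of [Q']. *)
suff -> : (fun _ : M => True) = A by [].
apply/funext => a; apply/propext; split=> // _.
have Ac x y : A (c x y).
  by apply: c_generators => // k l; apply: CA; apply/InP; exists (k, l); rewrite ?mem_enum.
suff [b Ab /emb_inj <-] : exists2 b, A b & emb b = emb a by [].
apply: (@emb_der a (fun x => exists2 b, A b & emb b = x)).
- by exists 0%R; [case: sA => -[]|exact: emb0].
- move=> _ _ [b Ab <-] [b' Ab' <-]; exists (b + b')%R => //.
  by apply: subgroupPD => //; case: sA.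
- by move=> _ [b Ab <-]; exists (- b)%R; [apply: subgroupPN => //; case: sA|exact: embN].
- by move=> x y; exists (c x y).
Qed.

Section ModuloStable.
Variable K : M -> Prop.
Hypothesis sK : stable op K.
Let sgK : subgroupP K := sK.1.

(** The operator [x - 1] of the group ring. *)
Definition displacement x a := (act x a - a)%R.

Lemma displacementD x : {morph displacement x : a b / (a + b)%R}.
Proof. by move=> a b; rewrite /displacement actD opprD addrACA. Qed.

Lemma stable_displacement x a : K a -> K (displacement x a).
Proof. by move=> Ka; apply: sgK.2 => //; apply: stable_act. Qed.

Lemma displacement_act x y a : displacement x (act y a) = act y (displacement x a).
Proof. by rewrite /displacement (morphDB (@actD y)) actC. Qed.

Lemma c_expg x v n : c (x ^+ n) v = (\sum_(j < n) act (x ^+ j) (c x v))%R.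
Proof.
elim: n => [|n IH]; first by rewrite big_ord0 c_eq0 //; apply/commute_sym/commute1.
by rewrite expgS c_mul IH big_ord_recr /= addrC.
Qed.

(* Modulo [K], [1 + x + ... + x ^ (n - 1)] is the sum of the injective operator [n] and of
   a nilpotent operator commuting with it, so it is injective. *)
Lemma c_expg_injective x v n p :
  (forall a, K (iter p (displacement x) a)) -> (forall a, K (a *+ n)%R -> K a) ->
  K (c (x ^+ n) v) -> K (c x v).
Proof.
move=> xnil ninj Kxn; apply: contrapT => nKz.
(* Modulo [K], the element [iter h r (c x v)] is non-zero and fixed by [x], so the geometric sum
   multiplies it by [n]. *)
have [h [nKy Ky]] := nilpotent_annihilated xnil nKz; apply: nKy; apply: ninj.
set r := displacement x in Ky *.
have rD := iter_morphD (@displacementD x) h; rewrite -/r in rD.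
have rK a : K a -> K (iter h r a).
  by elim: h {Ky rD} => //= h IH /IH; apply: stable_displacement.
have rA y a : iter h r (act y a) = act y (iter h r a).
  by elim: h {Ky rD rK} => //= h ->; rewrite /r displacement_act.
move: Kxn => /rK; rewrite c_expg (big_morph _ rD (morphD0 rD)).
under eq_bigr => j _ do rewrite rA.
move: (iter h r (c x v)) Ky => y Ky Ksum.
have Kj j : K (act (x ^+ j) y - y)%R.
  elim: j => [|j IH]; first by rewrite expg0 act1 subrr; case: sgK.
  rewrite expgS actM -(subrK (act (x ^+ j) y) (act (x ^+ j) (act x y))).
  rewrite -(morphDB (@actD (x ^+ j))) -addrA; apply: subgroupPD => //.
  exact: stable_act.
have -> : (y *+ n = \sum_(j < n) act (x ^+ j) y - \sum_(j < n) (act (x ^+ j) y - y))%R.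
  by rewrite sumrB opprB addrC subrK sumr_const card_ord.
apply: sgK.2 => //; elim/big_ind: _ => //; first by case: sgK.
by move=> a b; apply: subgroupPD.
Qed.

Lemma morphD_mulrz (f : M -> M) a (m : int) :
  {morph f : a b / (a + b)%R} -> f (a *~ m)%R = (f a *~ m)%R.
Proof.
move=> fD; have fn n : f (a *+ n)%R = (f a *+ n)%R.
  by elim: n => [|n IH]; rewrite ?mulr0n ?(morphD0 fD) // !mulrS fD IH.
case: m => n; first exact: fn.
by rewrite NegzE !mulrNz -[X in f X]sub0r (morphDB fD) (morphD0 fD) sub0r fn.
Qed.

Lemma mulrz_morphD (m : int) : {morph (fun a : M => a *~ m)%R : a b / (a + b)%R}.
Proof. by move=> a b; rewrite mulrzDl. Qed.

Hypothesis irrK : irreducible_mod op K.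

(** Otherwise every [m j] is nilpotent modulo [K], and some [y] outside [K] is killed modulo [K] by
    all of them; but [y] is the sum of the [y *~ (m j * u j)]. *)
Lemma unimodular_injective n (m u : 'I_n -> int) : (exists a, ~ K a) ->
  (\sum_j m j * u j = 1)%R -> exists j, forall a, K (a *~ m j)%R -> K a.
Proof.
move=> [a0 na0] mu1; apply: contrapT => ninj.
have nil j : exists p, forall a, K (iter p (fun a => a *~ m j)%R a).
  have [||inj|//] := irreducible_primary opD derived_noeth sK (@mulrz_morphD (m j)) _ _ irrK.
  - by move=> f /opD fD a; rewrite morphD_mulrz.
  - by move=> a; apply: subgroupPMz.
  by case: ninj; exists j.
have [y nKy Ky] : exists2 y, ~ K y & forall j, j \in enum 'I_n -> K (y *~ m j)%R.
  elim: (enum 'I_n) => [|j s [y nKy Ky]]; first by exists a0.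
  have [p jnil] := nil j.
  have [h [nKh Kh]] := nilpotent_annihilated jnil nKy.
  exists (iter h (fun a => a *~ m j)%R y) => // l; rewrite inE => /predU1P[-> //|/Ky Kl].
  elim: h {nKh Kh} => //= h IH; rewrite mulrzAC; exact: subgroupPMz.
apply: nKy; rewrite -[y]mulr1z -mu1 mulrz_sumr.
elim/big_ind: _ => [|a b|j _]; [by case: sgK|exact: subgroupPD|].
by rewrite mulrzA; apply: subgroupPMz => //; apply: Ky; rewrite mem_enum.
Qed.

End ModuloStable.

(** * Bounds on families of commuting pairs *)

Definition commuting_pairs (x y : nat -> Q) (I : seq nat) :=
  forall k l, k \in I -> l \in I -> k != l ->
  [/\ commute (x k) (x l), commute (x k) (y l) & commute (y k) (y l)].

(** The indices form a list of naturals so that a family can be split by filtering. *)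
Definition bounded K := exists N, forall (x y : nat -> Q) I, uniq I -> commuting_pairs x y I ->
  (forall k, k \in I -> ~ K (c (x k) (y k))) -> size I <= N.

Lemma irreducible_bounded K : stable op K -> irreducible_mod op K -> bounded K.
Proof.
move=> sK irrK; exists (#|{: 'I_d.+1 * 'I_d.+1}|) => x y I uI xyI nK.
have sgK := sK.1.
rewrite leqNgt; apply/negP => ltI.
(* [z] commutes with the pair at some other index [l], so [z - 1] kills [c (x l) (y l)], which is
   outside [K]; not being injective, it is nilpotent modulo [K]. *)
have unip k (z : Q) : k \in I -> (forall l, l \in I -> k != l ->
    commute z (x l) /\ commute z (y l)) ->
    exists p, forall a, K (iter p (displacement z) a).
  move=> kI zC; have [||inj|//] := irreducible_primary opD derived_noeth sK
    (@displacementD z) _ _ irrK.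
  - by move=> f /op_act[t ->] a; rewrite displacement_act.
  - by move=> a; apply: stable_displacement.
  have [l lI kl] : exists2 l, l \in I & k != l.
    have : 0 < size (rem k I).
      by rewrite size_rem // -ltnS prednK ?(leq_trans _ ltI) // ltnS card_prod card_ord.
    case E : (rem k I) => [//|l s] _; exists l.
      by apply: (mem_rem (x := k)); rewrite E mem_head.
    have : l \in rem k I by rewrite E mem_head.
    by rewrite rem_filter // mem_filter eq_sym => /andP[].
  have [zx zy] := zC l lI kl; case: (nK l lI); apply: inj.
  by rewrite /displacement act_fix // subrr; case: sgK.
(* The first entries of [I] are arranged in a square: [f (a, b)] is position [b] of block [a]. *)
pose f (p : 'I_d.+1 * 'I_d.+1) := nth 0 I (enum_rank p).
have flt (p : 'I_d.+1 * 'I_d.+1) : enum_rank p < size I by exact: ltn_trans (ltn_ord _) ltI.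
have fI p : f p \in I by apply: mem_nth; apply: flt.
have fne p q : p != q -> f p != f q.
  rewrite /f nth_uniq ?flt // => pq.
  by apply: contra pq => /eqP/ord_inj/enum_rank_inj ->.
have nKf : exists a, ~ K a by exists (c (x (f (ord0, ord0))) (y (f (ord0, ord0)))); apply: nK.
(* For each block, [mb] records the exponents of a relation between its [x]'s and a position whose
   exponent is injective modulo [K]. *)
have /choice[rx rxP] (a : 'I_d.+1) : exists mb : ('I_d.+1 -> int) * 'I_d.+1,
    der (\prod_(b < d.+1) zexpg (x (f (a, b))) (mb.1 b)) /\
    forall z, K (z *~ mb.1 mb.2)%R -> K z.
  have [m [u [mu dm]]] := derived_relation gen (fun b : 'I_d.+1 => x (f (a, b))).
  by have [b bP] := unimodular_injective sK irrK nKf mu; exists (m, b).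
pose be (a : 'I_d.+1) := (rx a).2.
have [n [u [nu dn]]] := derived_relation gen (fun a : 'I_d.+1 => y (f (a, be a))).
have [al alP] := unimodular_injective sK irrK nKf nu.
have [dm beP] := rxP al; rewrite -/(be al) in beP; move: (rx al).1 dm beP => m dm beP.
have C0 := QM dm dn.
set k := f (al, be al).
have xE (b : 'I_d.+1) (a : 'I_d.+1) : (al, b) != (a, be a) ->
    commute (x (f (al, b))) (y (f (a, be a))).
  by move=> /fne ne; have [] := xyI _ _ (fI (al, b)) (fI (a, be a)) ne.
(* When [b] differs from [be al], the pair at [(al, b)] is not among the selected ones, so its [x]
   commutes with the whole product of [y]'s and drops out of [C0]. *)
have C1 : commute (zexpg (x k) (m (be al))) (\prod_(a < d.+1) zexpg (y (f (a, be a))) (n a)).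
  apply: commute_sym; apply: (commute_prod_factor (s := index_enum _)
    (F := fun b : 'I_d.+1 => zexpg (x (f (al, b))) (m b)) (j0 := be al));
    rewrite ?index_enum_uniq ?mem_index_enum //.
  move=> b bne; apply: commute_sym; apply: commute_prod => a _.
  apply: commute_zexpg; apply: commute_sym; apply: commute_zexpg; apply: commute_sym.
  apply: xE; apply: contra bne => /eqP[-> ->] //.
have C2 : commute (zexpg (x k) (m (be al))) (zexpg (y k) (n al)).
  apply: (commute_prod_factor (s := index_enum _)
    (F := fun a : 'I_d.+1 => zexpg (y (f (a, be a))) (n a)) (j0 := al) _ _ _ C1);
    rewrite ?index_enum_uniq ?mem_index_enum //.
  move=> a ane; apply: commute_zexpg; apply: commute_sym; apply: commute_zexpg.
  by apply: commute_sym; apply: xE; apply: contra ane => /eqP[->].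
have C3 : commute (x k ^+ `|m (be al)|) (y k ^+ `|n al|).
  apply: commute_absz; apply: commute_sym; apply: commute_absz; exact: commute_sym.
have injn (e : int) : (forall z, K (z *~ e)%R -> K z) -> forall z, K (z *+ `|e|)%R -> K z.
  move=> inj z Kz; apply: inj; case: e Kz => // e Kz.
  by rewrite NegzE mulrNz; apply: subgroupPN.
have kI : k \in I by apply: fI.
have [p xp] : exists p, forall a, K (iter p (displacement (x k)) a).
  by apply: (unip k) => // l lI kl; have [] := xyI k l kI lI kl.
have [q yq] : exists p, forall a, K (iter p (displacement (y k)) a).
  apply: (unip k) => // l lI kl; have [_ _ ?] := xyI k l kI lI kl.
  by rewrite eq_sym in kl; have [_ /commute_sym ? _] := xyI l k lI kI kl.
(* The exponents are removed one at a time, first that of [y k], then that of [x k]; antisymmetry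
   brings each power into the first argument. *)
apply: (nK k kI); rewrite -[K _]/(K (c (x k) (y k))) c_swap; apply: subgroupPN => //.
apply: (c_expg_injective sK yq (injn _ alP)).
rewrite c_swap; apply: subgroupPN => //.
apply: (c_expg_injective sK xp (injn _ beP)).
by rewrite c_eq0 //; case: sgK.
Qed.

Lemma stable_bounded K : stable op K -> bounded K.
Proof.
apply: (noeth_ind derived_noeth) => {}K sK IH.
have [|nirr] := pselect (irreducible_mod op K); first exact: irreducible_bounded.
apply: contrapT => nb; apply: nirr => K1 K2 sK1 sK2 KK1 KK2 K12.
apply: contrapT => /not_orP[n1 n2]; apply: nb.
have [N1 b1] := IH K1 sK1 KK1 n1; have [N2 b2] := IH K2 sK2 KK2 n2.
exists (N1 + N2) => x y I uI xyI nK.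
(* At most [N1] indices have their commutator outside [K1]; the others have it in [K1], hence
   outside [K2], and there are at most [N2] of them. *)
pose P k := `[< K1 (c (x k) (y k)) >].
have sub R : commuting_pairs x y (filter R I).
  by move=> k l; rewrite !mem_filter => /andP[_ ?] /andP[_ ?]; apply: xyI.
rewrite -(count_predC P) addnC -!size_filter leq_add //.
  apply: (b1 x y); rewrite ?filter_uniq //.
  by move=> k; rewrite mem_filter /= => /andP[/asboolPn].
apply: (b2 x y); rewrite ?filter_uniq //.
by move=> k; rewrite mem_filter /= => /andP[/asboolP K1k kI] K2k; apply: (nK k kI); apply: K12.
Qed.

End MetabelianModule.

Theorem metabelian_commuting_pairs (Q : groupType) d (g : 'I_d -> Q) :
  generates g -> (forall x y : Q, der x -> der y -> commute x y) ->
  exists N, forall x y : 'I_N -> Q,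
    (forall k l, k != l ->
      [/\ commute (x k) (x l), commute (x k) (y l) & commute (y k) (y l)]) ->
    exists k, commute (x k) (y k).
Proof.
move=> gen QM; have [M [emb [emb_inj embD emb_der emb_surj]]] := derived_zmod QM.
have /choice[act0 act0P] (xa : Q * M) : exists b, emb b = emb xa.2 ^ xa.1.
  by apply: emb_surj; apply: derJ; apply: emb_der.
have /choice[c0 c0P] (xy : Q * Q) : exists b, emb b = [~ xy.1, xy.2].
  by apply: emb_surj; exact: derR.
pose act x a := act0 (x, a); pose c x y := c0 (x, y).
have emb_act x a : emb (act x a) = emb a ^ x by apply: (act0P (x, a)).
have emb_c x y : emb (c x y) = [~ x, y] by apply: (c0P (x, y)).
(* For [K = 0], a commutator outside [K] means a pair that does not commute. *)
have [|N bN] := stable_bounded gen QM emb_inj embD emb_der emb_act emb_c (K := fun a => a = 0%R).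
  by apply: stable0 => f; apply: (opD emb_inj embD emb_act).
exists N.+1 => x y xyC; apply: contrapT => nC.
pose ext (z : 'I_N.+1 -> Q) (k : nat) := z (inord k).
have := bN (ext x) (ext y) (iota 0 N.+1); rewrite size_iota ltnn => /(_ (iota_uniq _ _)).
move=> H; suff : false by []; apply: H.
  move=> k l; rewrite !mem_iota !add0n => kN lN kl; apply: xyC.
  by apply: contra kl => /eqP/(congr1 val) /=; rewrite !inordK // => ->.
move=> k _ ck; apply: nC; exists (inord k); apply/commgP/eqP.
by rewrite -emb_c ck (emb0 embD).
Qed.

(** * Derived series of setoid groups and weak identities *)

(** The transfer principle for what follows: an identity in the setoid group [G] is pushed through
    [p] and checked in [Q]. *)
Lemma group_model (G : grp) : is_group G -> exists (Q : groupType) (p : G -> Q),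
  (forall x y, p x = p y <-> geq x y) /\ (forall z, exists x, p x = z) /\
  (forall x y, p (gmul x y) = p x * p y) /\ p gone = 1 /\
  (forall x, p (ginv x) = (p x)^-1) /\ (forall x y, p (gcomm x y) = [~ p x, p y]) /\
  (forall l, p (gprod l) = \prod_(x <- l) p x).
Proof.
move=> gG; have [Q [p [pE pM pS]]] := quotient_group gG.
have [_ [_ [_ [_ [_ [_ [g1 gV]]]]]]] := gG.
have p1 : p gone = 1 by apply: (@mulIg _ (p gone)); rewrite -pM mul1g; apply/pE.
have pV x : p (ginv x) = (p x)^-1.
  by apply: (@mulIg _ (p x)); rewrite -pM mulVg -p1; apply/pE.
exists Q, p; do !split => //; try exact: (pE _ _).1; try exact: (pE _ _).2.
  by move=> x y; rewrite /gcomm !pM !pV commgEl conjgE !mulgA.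
by elim=> [|x l IH]; rewrite ?big_nil // big_cons -IH -pM.
Qed.

Definition setoid_subgroup (G : grp) (P : G -> Prop) :=
  [/\ forall x y, geq x y -> P x -> P y, P gone,
      forall x y, P x -> P y -> P (gmul x y) & forall x, P x -> P (ginv x)].

Section DerivedPredicate.
Variables (G : grp) (P : G -> Prop).
Hypothesis gG : is_group G.

Lemma derived_subgroup : setoid_subgroup (derived P).
Proof.
have [Q [p [pE [_ [pM [p1 [pV [pR pP]]]]]]]] := group_model gG.
have pc l : p (gprod [seq gcomm a.1 a.2 | a <- l]) = \prod_(a <- l) [~ p a.1, p a.2].
  by rewrite pP big_map; apply: eq_bigr => a _; rewrite pR.
split.
- move=> x y /pE xy [l [lP xl]]; exists l; split => //.
  by apply/pE; rewrite -xy; apply/pE.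
- by exists [::]; split => //; apply/pE.
- move=> x y [l [lP /pE xl]] [l' [l'P /pE yl']]; exists (l ++ l'); split.
    by move=> a /(@List.in_app_or _ l l')[/lP|/l'P].
  by apply/pE; rewrite pM xl yl' !pc big_cat.
(* The inverse of [[~ x, y]] is [[~ y, x]], so inversion reverses the list and swaps each pair. *)
- move=> x [l [lP /pE xl]]; exists (rev [seq (a.2, a.1) | a <- l]); split.
    elim: l lP {xl} => [|b l IH] lP a //=; rewrite rev_cons -cats1.
    case/(@List.in_app_or _ (rev [seq (a0.2, a0.1) | a0 <- l]) [:: (b.2, b.1)]) => [/IH|[<-|//]].
      by apply=> a' la'; apply: lP; right.
    by have [|] := lP b; first by left.
  apply/pE; rewrite pV xl !pc {xl lP}; elim: l => [|b l IH]; first by rewrite !big_nil invg1.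
  by rewrite big_cons invgM IH map_cons rev_cons -cats1 big_cat big_seq1 invgR.
Qed.

Lemma derived_gcomm x y : P x -> P y -> derived P (gcomm x y).
Proof.
have [gr [gs [gt [gm [gi [ga [g1 gV]]]]]]] := gG.
move=> Px Py; exists [:: (x, y)]; split; first by move=> a [<-|].
have [Q [p [pE [_ [pM [p1 _]]]]]] := group_model gG.
by apply/pE; rewrite /= pM p1 mulg1.
Qed.

Lemma derived_sub (R : G -> Prop) : setoid_subgroup R ->
  (forall x y, P x -> P y -> R (gcomm x y)) -> forall x, derived P x -> R x.
Proof.
have [_ [gs _]] := gG.
move=> [Rr R1 RM _] RP x [l [lP /gs]]; move/Rr; apply.
elim: l lP => //= a l IH lP; apply: RM; last by apply: IH => b lb; apply: lP; right.
by have [|? ?] := lP a; [left|apply: RP].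
Qed.

End DerivedPredicate.

Definition dseries (G : grp) n : G -> Prop := iter n (@derived G) (fun _ => True).

Lemma dseries_subgroup (G : grp) n : is_group G -> setoid_subgroup (@dseries G n).
Proof. by case: n => [|n] gG; [split|apply: derived_subgroup]. Qed.

Lemma dseriesS (G : grp) n x : is_group G -> @dseries G n.+1 x -> dseries n x.
Proof.
move=> gG; have sD := dseries_subgroup n gG; apply: derived_sub => // {}x y Dx Dy.
have [_ _ DM DV] := sD.
exact: (DM _ _ (DM _ _ (DV _ Dx) (DV _ Dy)) (DM _ _ Dx Dy)).
Qed.

Lemma dseries_leq (G : grp) m n (x : G) : is_group G -> m <= n -> @dseries G n x -> dseries m x.
Proof.
move=> gG /subnK <-; elim: (n - m) => // k IH; rewrite addSn => /dseriesS H.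
exact/IH/H.
Qed.

Lemma hom_one (G H : grp) (f : G -> H) : is_group G -> is_group H -> is_hom f ->
  geq (f gone) gone.
Proof.
move=> gG gH [fr fM]; have [Q [p [pE [_ [pM [p1 _]]]]]] := group_model gH.
have [_ [_ [_ [_ [_ [_ [g1 _]]]]]]] := gG.
apply/pE; rewrite p1; apply: (@mulgI _ (p (f gone))); rewrite mulg1 -pM.
have /pE <- := fM gone gone; apply/pE; exact: fr.
Qed.

Lemma hom_inv (G H : grp) (f : G -> H) x : is_group G -> is_group H -> is_hom f ->
  geq (f (ginv x)) (ginv (f x)).
Proof.
move=> gG gH fh; have [Q [p [pE [_ [pM [p1 [pV _]]]]]]] := group_model gH.
have [_ [_ [_ [_ [_ [_ [_ gV]]]]]]] := gG; have [fr fM] := fh.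
apply/pE; apply: (@mulIg _ (p (f x))); rewrite pV mulVg -pM.
have /pE <- := fM (ginv x) x; rewrite -p1.
have /pE <- := hom_one gG gH fh; apply/pE; exact: fr.
Qed.

Lemma hom_gcomm (G H : grp) (f : G -> H) x y : is_group G -> is_group H -> is_hom f ->
  geq (f (gcomm x y)) (gcomm (f x) (f y)).
Proof.
move=> gG gH fh; have [Q [p [pE [_ [pM [p1 [pV _]]]]]]] := group_model gH.
have fM a b : p (f (gmul a b)) = p (f a) * p (f b) by rewrite -pM; apply/pE; apply: fh.2.
have fV a : p (f (ginv a)) = (p (f a))^-1 by rewrite -pV; apply/pE; apply: hom_inv.
by apply/pE; rewrite /gcomm !fM !fV !pM !pV.
Qed.

Lemma hom_preim (G H : grp) (f : G -> H) (R : H -> Prop) : is_group G -> is_group H ->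
  is_hom f -> setoid_subgroup R -> setoid_subgroup (fun x => R (f x)).
Proof.
move=> gG gH fh [Rr R1 RM RV]; have [_ [gs _]] := gH; split.
- by move=> x y xy; apply: Rr; apply: fh.1.
- by apply: Rr R1; apply/gs/hom_one.
- by move=> x y Rx Ry; apply: (Rr (gmul (f x) (f y))); [apply/gs/fh.2|apply: RM].
- by move=> x Rx; apply: (Rr (ginv (f x))); [apply/gs/hom_inv|apply: RV].
Qed.

Lemma hom_dseries (G H : grp) (f : G -> H) n x : is_group G -> is_group H -> is_hom f ->
  @dseries G n x -> dseries n (f x).
Proof.
move=> gG gH fh; elim: n x => // n IH x.
have sD := dseries_subgroup n.+1 gH; have [_ [gs _]] := gH.
apply: (derived_sub gG (hom_preim gG gH fh sD)).
move=> {}x y Dx Dy; have [Dr _ _ _] := sD; apply: (Dr (gcomm (f x) (f y))).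
  exact/gs/hom_gcomm.
by apply: derived_gcomm => //; apply: IH.
Qed.

Lemma conj_hom (G : grp) (y : G) : is_group G ->
  @is_hom G G (fun x => gmul (gmul y x) (ginv y)).
Proof.
move=> gG; have [Q [p [pE [_ [pM [p1 [pV _]]]]]]] := group_model gG.
split=> [x x' /pE xx'|x x']; apply/pE; rewrite !pM ?xx' // !pV.
by rewrite !mulgA mulgVK.
Qed.

Lemma quot_group (G : grp) (K : G -> Prop) : is_group G -> setoid_subgroup K ->
  (forall x y, K x -> K (gmul (gmul y x) (ginv y))) -> is_group (quot K).
Proof.
move=> gG [Kr K1 KM KV] KJ.
have [Q [p [pE [_ [pM [p1 [pV _]]]]]]] := group_model gG.
have Kp x y : p x = p y -> K x -> K y by move/pE; apply: Kr.
split; [|split; [|split; [|split; [|split; [|split; [|split]]]]]] => /=.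
- by move=> x; apply: Kp K1; rewrite pM pV p1 mulgV.
- by move=> x y /KV; apply: Kp; rewrite !(pM, pV) invgM invgK.
- by move=> x y z Kx Ky; apply: (Kp _ _ _ (KM _ _ Kx Ky)); rewrite !(pM, pV) divgKA.
- move=> x x' y y' Kx Ky; apply: (Kp _ _ _ (KM _ _ (KJ _ x Ky) Kx)).
  by rewrite !(pM, pV) invgM !mulgA mulgVK.
- move=> x x' Kx; apply: (Kp _ _ _ (KV _ (KJ _ (ginv x) Kx))).
  by rewrite !(pM, pV) !invgM !invgK !mulgA mulgVK.
- by move=> x y z; apply: Kp K1; rewrite !(pM, pV) p1 mulgA mulgV.
- by move=> x; apply: Kp K1; rewrite !(pM, pV) p1 mul1g mulgV.
- by move=> x; apply: Kp K1; rewrite !(pM, pV) p1 mulVg mulgV.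
Qed.

(** Conjugation is an endomorphism, and endomorphisms preserve the derived series, whence
    normality. *)
Lemma quot_dseries_group (G : grp) n : is_group G -> is_group (quot (@dseries G n)).
Proof.
move=> gG; apply: quot_group => //; first exact: dseries_subgroup.
move=> x y Dx; exact: (hom_dseries gG gG (conj_hom y gG) Dx).
Qed.

Lemma quot_one (G : grp) (K : G -> Prop) x : is_group G ->
  setoid_subgroup K -> (@geq (quot K) x gone <-> K x).
Proof.
move=> gG [Kr _ _ _]; have [Q [p [pE [_ [pM [p1 [pV _]]]]]]] := group_model gG.
by split; apply: Kr; apply/pE; rewrite !(pM, pV) p1 invg1 mulg1.
Qed.

(** * The free group, its homomorphisms and verbal subgroups *)

Lemma winv_cat u v : winv (u ++ v) = winv v ++ winv u.
Proof. by rewrite /winv map_cat rev_cat. Qed.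

Lemma freq_winvl w : freq (winv w ++ w) [::].
Proof.
elim: w => [|[k b] w IH]; first exact: freq_refl.
rewrite -[(k, b) :: w]/([:: (k, b)] ++ w) winv_cat -catA.
apply: freq_trans IH; apply: freq_cat; first exact: freq_refl.
rewrite catA -[X in freq _ X]/([::] ++ w); apply: freq_cat; last exact: freq_refl.
by have := freq_cancel k (~~ b); rewrite negbK.
Qed.

Lemma freq_winv w v : freq w v -> freq (winv w) (winv v).
Proof.
elim=> {w v} [w|w v _|u v w _ uv _ vw|u u' v v' _ uu' _ vv'|k b].
- exact: freq_refl.
- exact: freq_sym.
- exact: freq_trans vw.
- by rewrite !winv_cat; apply: freq_cat.
- by rewrite /winv /= /rev /= negbK; apply: freq_cancel.
Qed.

Lemma FreeG_group : is_group FreeG.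
Proof.
split; [|split; [|split; [|split; [|split; [|split; [|split]]]]]] => /=.
- exact: freq_refl.
- exact: freq_sym.
- exact: freq_trans.
- by move=> u u' v v'; apply: freq_cat.
- exact: freq_winv.
- by move=> u v w; rewrite catA; apply: freq_refl.
- exact: freq_refl.
- exact: freq_winvl.
Qed.

Lemma weval_hom (G : grp) (a : nat -> G) : is_group G -> @is_hom FreeG G (weval a).
Proof.
move=> gG; have [Q [p [pE [_ [pM [p1 [pV [_ pP]]]]]]]] := group_model gG.
pose ev w := \prod_(l <- w) (if l.2 then (p (a l.1))^-1 else p (a l.1)).
have evE w : p (weval a w) = ev w.
  by rewrite /weval pP big_map; apply: eq_bigr => -[k []] _ //=; rewrite pV.
split=> [w v wv|w v]; apply/pE; rewrite ?pM !evE; last by rewrite /ev big_cat.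
elim: wv => {w v} [//|w v _ -> //|u v w _ -> //|u u' v v' _ uu' _ vv'|k b].
  by rewrite /ev !big_cat -!/(ev _) uu' vv'.
by rewrite /ev big_cons big_seq1 big_nil; case: b => /=; rewrite ?mulVg ?mulgV.
Qed.

Lemma weval1 (G : grp) (a : nat -> G) k : is_group G -> geq (weval a [:: (k, false)]) (a k).
Proof.
move=> gG; have [Q [p [pE [_ [pM [p1 _]]]]]] := group_model gG.
by apply/pE; rewrite /weval /= pM p1 mulg1.
Qed.

Lemma hom_comp (G H L : grp) (f : G -> H) (h : H -> L) : is_group L ->
  is_hom f -> is_hom h -> is_hom (fun x => h (f x)).
Proof.
move=> [_ [_ [gt _]]] [fr fM] [hr hM]; split=> x y; first by move/fr/hr.
by apply: (gt _ _ _ _ (hM _ _)); apply: hr.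
Qed.

Lemma free_hom_ext (G : grp) (f h : FreeG -> G) : is_group G -> is_hom f -> is_hom h ->
  (forall k, geq (f [:: (k, false)]) (h [:: (k, false)])) -> forall w, geq (f w) (h w).
Proof.
move=> gG fh hh fhE; have [Q [p [pE [_ [pM [p1 [pV _]]]]]]] := group_model gG.
have pf (e : FreeG -> G) : is_hom e -> [/\ p (e [::]) = 1,
    forall u v, p (e (u ++ v)) = p (e u) * p (e v) & forall w, p (e (winv w)) = (p (e w))^-1].
  move=> eh; split=> [|u v|w].
  - by rewrite -p1; apply/pE; apply: (hom_one FreeG_group gG eh).
  - by rewrite -pM; apply/pE; apply: eh.2.
  - by rewrite -pV; apply/pE; exact: (@hom_inv FreeG G e w FreeG_group gG eh).
have [f1 fM fV] := pf f fh; have [h1 hM hV] := pf h hh.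
elim=> [|[k b] w /pE IH]; apply/pE; first by rewrite f1 h1.
rewrite -[(k, b) :: w]/([:: (k, b)] ++ w) fM hM IH; congr (_ * _).
case: b; last exact/pE.
by rewrite -[[:: (k, true)]]/(winv [:: (k, false)]) fV hV; congr (_^-1); apply/pE.
Qed.

(* The even-indexed generators play the role of the variables of [pi1], the odd-indexed
   ones that of the variables of [pi2]. *)
Lemma free_hom_merge (G : grp) (pi1 pi2 : FreeG -> G) : is_group G ->
  is_hom pi1 -> is_hom pi2 ->
  exists (pi : FreeG -> G) (s1 s2 : FreeG -> FreeG), [/\ is_hom pi, is_hom s1, is_hom s2,
    forall w, geq (pi (s1 w)) (pi1 w) & forall w, geq (pi (s2 w)) (pi2 w)].
Proof.
move=> gG h1 h2; have [gr [gs [gt _]]] := gG.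
pose a k := if odd k then pi2 [:: (k./2, false)] else pi1 [:: (k./2, false)].
pose s (e : nat -> nat) : FreeG -> FreeG := @weval FreeG (fun k => [:: (e k, false)]).
have sh e : is_hom (s e) by apply: weval_hom FreeG_group.
have ah := weval_hom a gG.
have as_ (e : nat -> nat) k : geq (weval a (s e [:: (k, false)])) (a (e k)).
  apply: (gt _ _ _ (ah.1 _ _ (@weval1 FreeG (fun k => [:: (e k, false)]) k FreeG_group))).
  exact: weval1.
have ash e : @is_hom FreeG G (fun w => weval a (s e w)).
  by apply: (@hom_comp FreeG FreeG G (s e) (weval a)).
exists (weval a), (s double), (s (fun k => k.*2.+1)); split => //.
  apply: (free_hom_ext gG (ash double) h1) => k; apply: (gt _ _ _ (as_ _ _)).
  by rewrite /a odd_double doubleK.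
apply: (free_hom_ext gG (ash (fun k => k.*2.+1)) h2) => k; apply: (gt _ _ _ (as_ _ _)).
by rewrite /a /= odd_double /= uphalf_double.
Qed.

(** The values are closed under products and commutators because [free_hom_merge] evaluates two
    words in separate variables under one homomorphism; by induction they exhaust the derived
    series. *)
Lemma verbal_dseries (G : grp) n (x : G) : is_group G ->
  verbal (@dseries FreeG n) x <-> dseries n x.
Proof.
move=> gG; have gF := FreeG_group; have [gr [gs [gt [gm [gi _]]]]] := gG.
split=> [[h [pi [Dh [pih pix]]]]|].
  by have [Dr _ _ _] := dseries_subgroup n gG; exact: (Dr _ _ pix (hom_dseries gF gG pih Dh)).
elim: n x => [|n IH] x.
  (* Any [x] is the value of a generator under the homomorphism sending all generators to [x]. *)
  move=> _; exists [:: (0, false)], (weval (fun _ => x)).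
  by split => //; split; [exact: weval_hom|exact: weval1].
have [_ D1 DM DV] := dseries_subgroup n.+1 gF.
apply: derived_sub => //.
  split.
  - move=> y z yz [h [pi [Dh [pih piy]]]]; exists h, pi; split=> //; split=> //.
    exact: (gt _ _ _ piy yz).
  - exists [::], (weval (fun _ => gone)); split => //; split; first exact: weval_hom.
    exact: gr.
  - move=> y z [h [pi1 [Dh [pih piy]]]] [h' [pi2 [Dh' [pih' piz]]]].
    have [pi [s1 [s2 [ph s1h s2h e1 e2]]]] := free_hom_merge gG pih pih'.
    exists (s1 h ++ s2 h'), pi; split.
      exact: (DM _ _ (hom_dseries gF gF s1h Dh) (hom_dseries gF gF s2h Dh')).
    split=> //; apply: (gt _ _ _ (ph.2 _ _)); apply: gm.
      exact: (gt _ _ _ (e1 h) piy).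
    exact: (gt _ _ _ (e2 h') piz).
  - move=> y [h [pi [Dh [pih piy]]]]; exists (winv h), pi; split; first exact: DV.
    split=> //; apply: (gt _ _ _ (@hom_inv FreeG G pi h gF gG pih)); exact: (gi _ _ piy).
move=> {}x y /IH[h [pi1 [Dh [pih pix]]]] /IH[h' [pi2 [Dh' [pih' piy]]]].
have [pi [s1 [s2 [ph s1h s2h e1 e2]]]] := free_hom_merge gG pih pih'.
exists (@gcomm FreeG (s1 h) (s2 h')), pi; split.
  exact: (derived_gcomm gF (hom_dseries gF gF s1h Dh) (hom_dseries gF gF s2h Dh')).
split=> //; apply: (gt _ _ _ (hom_gcomm _ _ gF gG ph)).
have x1 : geq (pi (s1 h)) x := gt _ _ _ (e1 h) pix.
have y1 : geq (pi (s2 h')) y := gt _ _ _ (e2 h') piy.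
exact: (gm _ _ _ _ (gm _ _ _ _ (gi _ _ x1) (gi _ _ y1)) (gm _ _ _ _ x1 y1)).
Qed.

Lemma T_subgroup_dseries n : T_subgroup (@dseries FreeG n).
Proof.
split; first by have [] := dseries_subgroup n FreeG_group.
by move=> phi phih w; apply: (hom_dseries FreeG_group FreeG_group phih).
Qed.

Lemma T_subgroup_trivial : T_subgroup trivialT.
Proof.
split; first split.
- by move=> w v wv w1; apply: freq_trans w1; apply: freq_sym.
- exact: freq_refl.
- by move=> w v w1 v1; apply: (@freq_cat w [::] v [::]).
- by move=> w /freq_winv.
move=> phi phih w w1; apply: (freq_trans (phih.1 _ _ w1)).
exact: (hom_one FreeG_group FreeG_group phih).
Qed.

(** * Weak identities along the derived series *)

Lemma incl_hom N (k : 'I_N) : @is_hom FreeG (FpowN N) (@incl N k).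
Proof.
split=> [w v wv l|w v l] /=; rewrite /incl; case: eqP => _ //; exact: freq_refl.
Qed.

Lemma incl_commute N (k l : 'I_N) u v : k != l ->
  geq (gmul (incl k u) (incl l v)) (gmul (incl l v) (incl k u)).
Proof.
move=> kl j /=; rewrite /incl; have [->|jk] := eqVneq j k.
  by rewrite (negPf kl) cats0; apply: freq_refl.
by rewrite cats0; apply: freq_refl.
Qed.

(** This is [metabelian_commuting_pairs] for [G / G''], where a commutator lies in [dseries 2]
    exactly when the images commute. *)
Lemma fin_gen_commuting_pairs (G : grp) : is_group G -> fin_gen G ->
  exists N, forall x y : 'I_N -> G,
    (forall k l, k != l -> [/\ dseries 2 (gcomm (x k) (x l)),
       dseries 2 (gcomm (x k) (y l)) & dseries 2 (gcomm (y k) (y l))]) ->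
    exists k, dseries 2 (gcomm (x k) (y k)).
Proof.
move=> gG [gens gensG]; set D2 := @dseries G 2.
have sD2 : setoid_subgroup D2 := dseries_subgroup 2 gG.
have gQ : is_group (quot D2) := quot_dseries_group 2 gG.
have [Q [p [pE [pS [pM [p1 [pV [pR pP]]]]]]]] := group_model gQ.
have D2R x y : D2 (gcomm x y) <-> commute (p x) (p y).
  split=> [xy|/commgP/eqP]; last first.
    by rewrite -pR -p1 => /pE/(quot_one _ gG sD2).
  by apply/commgP/eqP; rewrite -pR -p1; apply/pE/(quot_one _ gG sD2).
have gr (x y : G) : @geq G x y -> p x = p y.
  have [Dr D1 _ _] := sD2; move=> xy; apply/pE; apply: Dr D1.
  have [R [q [qE [_ [qM [q1 [qV _]]]]]]] := group_model gG.
  have qxy : q x = q y by apply/qE.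
  by apply/qE; rewrite q1 qM qV qxy mulgV.
pose g (k : 'I_(size gens)) := p (nth gone gens k).
have gen : generates g.
  move=> P P1 Pg Pg' z; have [x <-] := pS z; have [w [wg /gr <-]] := gensG x.
  elim: w wg => [|[k b] w IH] wg; first by rewrite p1.
  have {}IH : P (p (weval (nth gone gens) w)).
    by apply: IH => l lw; apply: wg; rewrite inE lw orbT.
  have ks : k < size gens by apply: (wg (k, b)); rewrite mem_head.
  rewrite [p _]pM /=; case: b {wg} => /=; first by rewrite pV; exact: (Pg' (Ordinal ks)).
  exact: (Pg (Ordinal ks)).
(* Elements of [Q'] lift to [G'], so their commutators come from [G''] and [Q] is metabelian. *)
have derD1 z : der z -> exists2 x, @dseries G 1 x & p x = z.
  have [_ D1 DM DV] := dseries_subgroup 1 gG.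
  move=> /(_ (fun z => exists2 x, @dseries G 1 x & p x = z)); apply.
  - by exists gone.
  - by move=> _ _ [x Dx <-] [y Dy <-]; exists (gmul x y); [apply: DM|rewrite pM].
  - by move=> _ [x Dx <-]; exists (ginv x); [apply: DV|rewrite pV].
  - move=> a b; have [x <-] := pS a; have [y <-] := pS b.
    by exists (gcomm x y); [apply: derived_gcomm|rewrite pR].
have [|N NP] := metabelian_commuting_pairs gen.
  by move=> _ _ /derD1[x Dx <-] /derD1[y Dy <-]; apply/D2R; apply: derived_gcomm.
exists N => x y xy; have [|k kC] := NP (p \o x) (p \o y).
  by move=> k l /xy[xx xy' yy]; split; apply/D2R.
by exists k; apply/D2R.
Qed.

Lemma setoid_subgroup_one (G : grp) : is_group G ->
  setoid_subgroup (fun x : G => geq x gone).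
Proof.
move=> gG; have [Q [p [pE [_ [pM [p1 [pV _]]]]]]] := group_model gG.
split=> [x y /pE xy /pE x1||x y /pE x1 /pE y1|x /pE x1]; apply/pE.
- by rewrite -xy.
- by [].
- by rewrite pM x1 y1 p1 mulg1.
- by rewrite pV x1 p1 invg1.
Qed.

Lemma hom_derived_trivial (G H : grp) (f : G -> H) (P : G -> Prop) : is_group G ->
  is_group H -> is_hom f -> (forall x y, P x -> P y -> geq (gcomm (f x) (f y)) gone) ->
  forall x, derived P x -> geq (f x) gone.
Proof.
move=> gG gH fh fP; have [_ [_ [gt _]]] := gH.
apply: (derived_sub gG (hom_preim gG gH fh (setoid_subgroup_one gH))) => x y Px Py.
by apply: (gt _ _ _ (hom_gcomm x y gG gH fh)); apply: fP.
Qed.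

(** Induction on [i]: once F^(i+1) maps into G^(i+2), commutators of its elements map into G^(i+3).
    As [f] is multiplicative only modulo G^(n+1), this stops at [i < n]. *)
Lemma dseries_shift (G : grp) (f : FreeG -> G) n i : is_group G ->
  @is_hom FreeG (quot (@dseries G n.+1)) f ->
  (forall u v, dseries 2 (gcomm (f u) (f v))) ->
  i < n -> forall w, @dseries FreeG i.+1 w -> dseries i.+2 (f w).
Proof.
move=> gG [fr fM] f2.
have fh k : k <= n -> @is_hom FreeG (quot (@dseries G k.+1)) f.
  move=> kn; split=> [u v uv|u v]; apply: (@dseries_leq G _ n.+1) => //.
    exact: fr.
  exact: fM.
have gE k : is_group (quot (@dseries G k)) by apply: quot_dseries_group.
have oneE k x := quot_one x gG (dseries_subgroup k gG).
elim: i => [|i IH] ltin w Dw; apply/oneE.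
  apply: (@hom_derived_trivial FreeG (quot (@dseries G 2)) f (fun _ => True)
    FreeG_group (gE 2) (fh 1%N ltin) _ _ Dw) => u v _ _.
  by apply/oneE; apply: f2.
apply: (@hom_derived_trivial FreeG (quot (@dseries G i.+3)) f (@dseries FreeG i.+1)
  FreeG_group (gE i.+3) (fh i.+2 ltin) _ _ Dw) => u v Du Dv.
by apply/oneE; apply: derived_gcomm => //; apply: IH => //; apply: ltnW.
Qed.

(** If every [rho (incl k (s k))] were non-trivial, [dseries_shift] would give in each factor a pair
    not commuting modulo [G''], while distinct factors commute; this contradicts the choice of [N].
    The general [V] also covers the end of the chain, where it comes from the trivial
    [T]-subgroup. *)
Lemma weak_ids_dseries (G : grp) (V : G -> Prop) n : is_group G -> fin_gen G ->
  (forall x, V x <-> dseries n.+2 x) -> weak_ids (@dseries FreeG n.+1) (quot V).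
Proof.
move=> gG fG VE; have [N NP] := fin_gen_commuting_pairs gG fG.
have sD : setoid_subgroup (@dseries G n.+2) by apply: dseries_subgroup.
have -> : V = @dseries G n.+2 by apply/funext => x; apply/propext.
have {VE}gV : is_group (quot (@dseries G n.+2)) by apply: quot_dseries_group.
exists N; split.
  (* For [N = 0], [NP] would produce an element of the empty type ['I_0]. *)
  by case: N NP => // NP; have [[]|[]] := NP (fun=> gone) (fun=> gone).
move=> s sF rho rhoh; apply: contrapT => nk.
have rkh (k : 'I_N) : @is_hom FreeG (quot (@dseries G n.+2)) (fun w => rho (incl k w)).
  by apply: hom_comp => //; apply: incl_hom.
have /choice[uv uvP] (k : 'I_N) : exists uv : word * word,
    ~ @dseries G 2 (@gcomm G (rho (incl k uv.1)) (rho (incl k uv.2))).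
  apply: contrapT => nuv; apply: nk; exists k; apply/(quot_one _ gG sD).
  apply: (dseries_shift gG (rkh k) _ (leqnn _) (sF k)) => u v.
  by apply: contrapT => nD; apply: nuv; exists (u, v).
have rhoC (k l : 'I_N) u v : k != l ->
    @dseries G 2 (@gcomm G (rho (incl k u)) (rho (incl l v))).
  move=> kl; apply: (@dseries_leq G 2 n.+2) => //; apply/(quot_one _ gG sD).
  have [R [q [qE [_ [qM [q1 [qV [qR _]]]]]]]] := group_model gV.
  apply/qE; rewrite q1 [LHS]qR; apply/eqP/commgP; rewrite /commute -!qM; apply/qE.
  have [gr [gs [gt _]]] := gV; apply: (gt _ _ _ (gs _ _ (rhoh.2 _ _))).
  by apply: (gt _ _ _ _ (rhoh.2 _ _)); apply: rhoh.1; apply: incl_commute.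
have [|k] := NP (fun k => rho (incl k (uv k).1)) (fun k => rho (incl k (uv k).2)).
  by move=> k l kl; split; apply: rhoC.
exact: uvP.
Qed.

Theorem theorem5p9 (G : grp) :
  is_group G -> fin_gen G -> solvable_grp G ->
  weak_star_ids_mod Fprime trivialT G.
Proof.
move=> gG fG [n Gn]; have [_ [gs [gt _]]] := gG.
(* Term [j] is F^(j+1) up to [j = n], and term [n.+1] is trivial. *)
exists n.+1, (fun j => if j <= n then @dseries FreeG j.+1 else trivialT); split.
  by move=> j _; case: ifP => _; [apply: T_subgroup_dseries|apply: T_subgroup_trivial].
split; first by [].
split; first by rewrite ltnn.
move=> [//|j] /andP[_]; rewrite ltnS /= => jn; rewrite /weak_ids_mod jn.
apply: weak_ids_dseries => // x; case: ltnP => [_|nj]; first exact: (@verbal_dseries G j.+2 x gG).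
(* In the last link [j = n]: the verbal subgroup of the trivial [T]-subgroup is trivial, and so is
   G^(n+2), since G^(n) is. *)
split=> [[h [pi [h1 [pih pix]]]]|Dx].
  have [Dr D1 _ _] := dseries_subgroup j.+2 gG; apply: Dr D1; apply: (gt _ _ _ _ pix).
  apply: gs; apply: (gt _ _ _ (pih.1 _ _ h1)).
  exact: (hom_one FreeG_group gG pih).
exists [::], (weval (fun _ => gone)); split; first exact: freq_refl.
split; first exact: weval_hom.
apply: gs; apply: Gn; apply: dseries_leq Dx => //.
by rewrite (leq_trans nj) // leqW.
Qed.
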